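(* Let $B$ be a skew-symmetric integer $n\times n$ matrix whose mutation class is infinite. Then the cluster algebra $\mathfrak A(B)$ has exponential growth.
   Context: A seed is a pair $(f,B)$, where $f=\{f_1,\dots,f_n\}$ is a collection of algebraically independent rational functions in $\mathbb Q(x_1,\dots,x_n)$ and $B$ is an integer skew-symmetric $n\times n$ matrix (the exchange matrix). The mutation of $(f,B)$ in direction $k$ is the seed $(f',B')$, where $B'_{ij}=-B_{ij}$ if $i=k$ or $j=k$, $B'_{ij}=B_{ij}+\frac{|B_{ik}|B_{kj}+B_{ik}|B_{kj}|}{2}$ otherwise, and $f'_i=f_i$ for $i\neq k$, $f'_k=\frac{1}{f_k}\left(\prod_{B_{kj}>0}f_j^{B_{kj}}+\prod_{B_{kj}<0}f_j^{-B_{kj}}\right)$. The mutation class of $B$ is the set of all matrices obtained from $B$ by finite sequences of matrix mutations. The initial seed is $(\{x_1,\dots,x_n\},B)$, and the cluster algebra $\mathfrak A(B)$ is the subalgebra of $\mathbb Q(x_1,\dots,x_n)$ generated by all the elements $f_i$ of all seeds obtained from the initial seed by finite sequences of mutations. The cluster algebra is called mutation-infinite if the mutation class of $B$ is infinite. It has exponential growth if the number of distinct seeds which can be obtained from a fixed initial seed by at most $m$ mutations is bounded from below by an exponentially growing function of $m$ (i.e. by $C r^m$ for some constants $C>0$, $r>1$). *)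

(* Defs.v *)
From HB Require Import structures.
From mathcomp Require Import all_boot all_order all_algebra finmap.
From mathcomp Require Import classical_sets cardinality reals mpoly.
Set Implicit Arguments.
Unset Strict Implicit.
Unset Printing Implicit Defensive.
Import Order.TTheory GRing.Theory Num.Theory.

Local Open Scope ring_scope.

(* The field Q(x_1, ..., x_n). *)
Definition ratfun (n : nat) : fieldType := {fraction {mpoly rat[n]}}.

Definition ratfun_const (n : nat) (c : rat) : ratfun n := tofrac (c%:MP_[n]).

Definition ratfun_var (n : nat) (i : 'I_n) : ratfun n :=
  tofrac ('X_i : {mpoly rat[n]}).

Definition algebraically_independent (n : nat) (f : 'I_n -> ratfun n) : Prop :=
  forall P : {mpoly rat[n]}, mmap (@ratfun_const n) f P = 0 -> P = 0.

Definition skew_symmetric (n : nat) (B : 'M[int]_n) : Prop := B^T = - B.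

(* The underlying data of a seed. Seeds are labeled: the i-th row and column
   of the matrix correspond to the i-th function, and two seeds are equal when
   they agree entry by entry. *)
Definition preseed (n : nat) : choiceType :=
  ({ffun 'I_n -> ratfun n} * 'M[int]_n)%type.

Definition is_seed (n : nat) (s : preseed n) : Prop :=
  algebraically_independent s.1 /\ skew_symmetric s.2.

(* The integer division by 2 is exact, see mutation_even. *)
Definition mutate_mx (n : nat) (k : 'I_n) (B : 'M[int]_n) : 'M[int]_n :=
  \matrix_(i, j)
    if (i == k) || (j == k) then - B i j
    else B i j + ((`|B i k| * B k j + B i k * `|B k j|) %/ 2)%Z.

Definition mutate_fun (n : nat) (k : 'I_n) (s : preseed n) :
    {ffun 'I_n -> ratfun n} :=
  let: (f, B) := s in
  [ffun i => if i == k then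
      (f k)^-1 * (\prod_(j | 0 < B k j) f j ^ (B k j)
                  + \prod_(j | B k j < 0) f j ^ (- B k j))
    else f i].

Definition mutate (n : nat) (k : 'I_n) (s : preseed n) : preseed n :=
  (mutate_fun k s, mutate_mx k s.2).

Definition initial_seed (n : nat) (B : 'M[int]_n) : preseed n :=
  ([ffun i => ratfun_var i], B).

Definition mutation_class (n : nat) (B : 'M[int]_n) : set 'M[int]_n :=
  range (foldl (fun A k => mutate_mx k A) B).

Definition mutation_infinite (n : nat) (B : 'M[int]_n) : Prop :=
  infinite_set (mutation_class B).

(* See seeds_withinP for the description by sequences of at most m
   mutations. *)
Fixpoint seeds_within (n : nat) (B : 'M[int]_n) (m : nat) : {fset preseed n} :=
  if m is m'.+1 then
    (seeds_within B m' `|`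
     [fset mutate k s | s in seeds_within B m', k in 'I_n])%fset
  else [fset initial_seed B]%fset.

(* Growth of the cluster algebra A(B); it depends only on the seeds obtained
   from the initial seed. *)
Definition exponential_growth (R : realType) (n : nat) (B : 'M[int]_n) : Prop :=
  exists C r : R, [/\ 0 < C, 1 < r &
    forall m : nat, C * r ^+ m <= #|` seeds_within B m|%:R].

Lemma seeds_withinP (n : nat) (B : 'M[int]_n) (m : nat) (s : preseed n) :
  reflect (exists2 ks : seq 'I_n, (size ks <= m)%N
             & s = foldl (fun t k => mutate k t) (initial_seed B) ks)
          (s \in seeds_within B m).
Proof.
apply: (iffP idP).
  elim: m s => [|m IHm] s /=.
    by rewrite inE => /eqP ->; exists [::].
  rewrite in_fsetU => /orP[/IHm[ks le_ks ->]|].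
    by exists ks => //; apply: leqW.
  case/imfset2P => t /= t_in [k _ ->].
  have [ks le_ks ->] := IHm t t_in.
  by exists (rcons ks k); rewrite ?size_rcons // foldl_rcons.
case=> ks le_ks ->; elim/last_ind: ks m le_ks => [|ks k IHks] m.
  move=> _ /=; elim: m => [|m IHm] /=; first by rewrite inE.
  by rewrite in_fsetU IHm.
rewrite size_rcons foldl_rcons; case: m => // m le_ks /=.
rewrite in_fsetU; apply/orP; right.
by apply/imfset2P; exists (foldl (fun t k => mutate k t) (initial_seed B) ks);
  [exact: IHks | exists k].
Qed.

Lemma mutation_even (a b : int) : (2 %| `|a| * b + a * `|b|)%Z.
Proof.
have two c : (2 %| c + c)%Z by apply/dvdzP; exists c; rewrite mulr2n mulrDr mulr1.
case: (ger0P a) => _; case: (ger0P b) => _; rewrite ?mulrN ?mulNr ?subrr ?addNr //.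
Qed.

Lemma mutate_mx_skew (n : nat) (k : 'I_n) (B : 'M[int]_n) :
  skew_symmetric B -> skew_symmetric (mutate_mx k B).
Proof.
move=> skB; have sk i j : B j i = - B i j.
  by move/matrixP/(_ i j): skB; rewrite !mxE.
have half x : (2 %| x)%Z -> ((- x) %/ 2)%Z = - (x %/ 2)%Z.
  by case/dvdzP=> q ->; rewrite -mulNr !mulzK.
apply/matrixP => i j; rewrite !mxE orbC; case: ifP => _; first by rewrite sk.
rewrite (sk i j) (sk i k) (sk k j) !normrN opprD -half ?mutation_even //.
congr (_ + (_ %/ _)%Z); rewrite mulrN mulNr opprD addrC.
by rewrite [B k j * _]mulrC [X in _ - X]mulrC.
Qed.

Section AlgebraicIndependence.
Variables (n : nat) (k : 'I_n) (B : 'M[int]_n).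
Hypothesis skB : skew_symmetric B.
Local Notation K := (ratfun n).
Local Notation ev := (mmap (@ratfun_const n)).
Local Notation const := (@ratfun_const n).

Let Bkk : B k k = 0.
Proof.
move/matrixP/(_ k k): skB; rewrite !mxE => /eqP.
by rewrite -addr_eq0 -mulr2n mulrn_eq0 /= => /eqP.
Qed.

Let const_morph : GRing.RMorphism.type rat K :=
  (tofrac (R:={mpoly rat[n]}) \o @mpolyC n rat : {rmorphism rat -> K}).

Let exch (h : 'I_n -> K) : K :=
  \prod_(j | 0 < B k j) h j ^ (B k j) + \prod_(j | B k j < 0) h j ^ (- B k j).

Let mu (h : 'I_n -> K) (i : 'I_n) : K :=
  if i == k then (h k)^-1 * exch h else h i.

Let exchE h g : (forall i, i != k -> h i = g i) -> exch h = exch g.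
Proof.
move=> hg; rewrite /exch; congr (_ + _); apply: eq_bigr => j Bj.
  by rewrite hg //; apply: contraTneq Bj => ->; rewrite Bkk.
by rewrite hg //; apply: contraTneq Bj => ->; rewrite Bkk.
Qed.

Let exch_mu h : exch (mu h) = exch h.
Proof. by apply: exchE => i /negbTE ik; rewrite /mu ik. Qed.

Let E : {mpoly rat[n]} :=
  \prod_(j | 0 < B k j) 'X_j ^+ `|B k j|%N
  + \prod_(j | B k j < 0) 'X_j ^+ `|B k j|%N.

Let evX (h : 'I_n -> K) (i : 'I_n) : ev h ('X_i : {mpoly rat[n]}) = h i.
Proof. by rewrite (mmapX h const_morph) mmap1U. Qed.

Let evM (h : 'I_n -> K) (p q : {mpoly rat[n]}) : ev h (p * q) = ev h p * ev h q.
Proof. exact: (rmorphM (mmap (R:=rat) (S:=K) const_morph h)). Qed.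

Let evD (h : 'I_n -> K) (p q : {mpoly rat[n]}) : ev h (p + q) = ev h p + ev h q.
Proof. exact: (rmorphD (mmap (R:=rat) (S:=K) const_morph h)). Qed.

Let evXn (h : 'I_n -> K) (p : {mpoly rat[n]}) d : ev h (p ^+ d) = ev h p ^+ d.
Proof. exact: (rmorphXn (mmap (R:=rat) (S:=K) const_morph h)). Qed.

Let evZ (h : 'I_n -> K) c (p : {mpoly rat[n]}) : ev h (c *: p) = const c * ev h p.
Proof. exact: (mmapZ h const_morph). Qed.

Let ev0 (h : 'I_n -> K) : ev h 0 = 0.
Proof. exact: (mmap0 h const_morph). Qed.

Let ev_prod h (P : pred 'I_n) (e : 'I_n -> nat) :
  ev h (\prod_(i | P i) 'X_i ^+ e i) = \prod_(i | P i) h i ^+ e i.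
Proof.
rewrite (rmorph_prod (mmap (R:=rat) (S:=K) const_morph h)); apply: eq_bigr => i _ /=.
by rewrite -[RHS](congr1 (fun x => x ^+ e i) (evX h i)) -evXn.
Qed.

Let ev_E h : ev h E = exch h.
Proof.
rewrite /E evD !ev_prod /exch; congr (_ + _); apply: eq_bigr => j.
  by case: (B k j).
by case: (B k j) => // m _; rewrite NegzE opprK.
Qed.

Let E_neq0 : E != 0.
Proof.
apply/eqP => /(congr1 (fun p => meval (fun=> 1) p)).
rewrite meval0 mevalD !rmorph_prod /=.
rewrite !big1 => [|j _|j _]; first by move/eqP; rewrite -mulr2n pnatr_eq0.
  by rewrite rmorphXn /= mevalXU expr1n.
by rewrite rmorphXn /= mevalXU expr1n.
Qed.

Let X_neq0 : ('X_k : {mpoly rat[n]}) != 0.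
Proof.
by apply/eqP => /mpolyP/(_ U_(k)%MM)/eqP; rewrite mcoeffXU mcoeff0 eqxx oner_eq0.
Qed.

Let clear_denominators (P : {mpoly rat[n]}) : exists Q d,
  forall h, h k != 0 -> ev h Q = h k ^+ d * ev (mu h) P.
Proof.
elim/mpolyind: P => [|c m p _ _ [Q [d Qd]]].
  by exists 0, 0%N => h _; rewrite !ev0 mulr0.
pose M : {mpoly rat[n]} := E ^+ m k * \prod_(i | i != k) 'X_i ^+ m i.
exists ('X_k ^+ d * (c *: M) + 'X_k ^+ m k * Q), (d + m k)%N => h hk.
rewrite !evD !evM !evXn !evX Qd // mulrDr !evZ exprD -!mulrA.
congr (_ + _); last by rewrite mulrCA.
congr (_ * _); rewrite mulrCA; congr (_ * _).
have muk : mu h k = (h k)^-1 * exch h by rewrite /mu eqxx.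
rewrite (mmapX _ const_morph) /mmap1 (bigD1 k) //= muk.
rewrite mulrA -exprMn mulrA divff // mul1r.
rewrite evM evXn ev_E ev_prod; congr (_ * _).
by apply: eq_bigr => i /negbTE ik; rewrite /mu ik.
Qed.

Let var (i : 'I_n) : K := ratfun_var i.

Let ev_var p : ev var p = tofrac p.
Proof.
elim/mpolyind: p => [|c m p _ _ IH]; first by rewrite ev0 tofrac0.
rewrite evD evZ IH (mmapX _ const_morph) -mul_mpolyC tofracD tofracM.
congr (_ * _ + _); rewrite mpolyXE_id rmorph_prod /mmap1 /=.
by apply: eq_bigr => i _; rewrite tofracXn.
Qed.

Lemma initial_algebraically_independent :
  algebraically_independent (initial_seed B).1.
Proof.
move=> P; have -> : ev (initial_seed B).1 P = ev var P.
  by apply: eq_bigr => m _; congr (_ * _); apply: eq_bigr => i _; rewrite ffunE.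
by rewrite ev_var => /eqP; rewrite tofrac_eq0 => /eqP.
Qed.

Lemma mutate_algebraically_independent (f : {ffun 'I_n -> ratfun n}) :
  algebraically_independent f ->
  algebraically_independent (mutate k (f, B)).1.
Proof.
move=> indf P; have -> : ev (mutate k (f, B)).1 P = ev (mu f) P.
  apply: eq_bigr => m _; congr (_ * _); apply: eq_bigr => i _.
  by rewrite ffunE.
move=> Pf; have [Q [d Qd]] := clear_denominators P.
have fk : f k != 0.
  apply/eqP => fk0; have /indf/eqP : ev f 'X_k = 0 by rewrite evX.
  by rewrite (negbTE X_neq0).
have Q0 : Q = 0 by apply: indf; rewrite Qd // Pf mulr0.
have vk : var k != 0 by rewrite tofrac_eq0.
have ex : exch var != 0 by rewrite -ev_E ev_var tofrac_eq0.
have muk : mu var k != 0 by rewrite /mu eqxx mulf_neq0 ?invr_eq0.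
have := Qd (mu var) muk; rewrite Q0 ev0 => /esym/eqP.
rewrite mulf_eq0 expf_eq0 (negbTE muk) andbF /=.
have -> : ev (mu (mu var)) P = ev var P.
  apply: eq_bigr => m _; congr (_ * _); apply: eq_bigr => i _; congr (_ ^+ _).
  rewrite {1}/mu exch_mu; case: eqP => [->|/eqP/negbTE ik]; last by rewrite /mu ik.
  by rewrite /mu eqxx invfM invrK -mulrA mulVf // mulr1.
by rewrite ev_var tofrac_eq0 => /eqP.
Qed.

End AlgebraicIndependence.

Lemma initial_is_seed (n : nat) (B : 'M[int]_n) :
  skew_symmetric B -> is_seed (initial_seed B).
Proof. by split=> //; apply: initial_algebraically_independent. Qed.

Lemma mutate_is_seed (n : nat) (k : 'I_n) (s : preseed n) :
  is_seed s -> is_seed (mutate k s).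
Proof.
case: s => f B [indf skB]; split; last exact: mutate_mx_skew.
exact: mutate_algebraically_independent.
Qed.

Lemma seeds_within_is_seed (n : nat) (B : 'M[int]_n) (m : nat) (s : preseed n) :
  skew_symmetric B -> s \in seeds_within B m -> is_seed s.
Proof.
move=> skB /seeds_withinP[ks _ ->]; elim/last_ind: ks => [|ks k IHks] /=.
  exact: initial_is_seed.
by rewrite foldl_rcons; apply: mutate_is_seed.
Qed.

(* Main.v *)
Require Import Defs.
From mathcomp Require Import all_boot all_order all_algebra.
From mathcomp Require Import reals.
From mathcomp Require Import finmap zify.
From mathcomp Require boolp classical_sets cardinality.

(** Matrices alone already witness the growth.  Take a sequence of mutations of
    [B] and stop when an entry first exceeds a bound [N >= 2] on the entries of
    [B]: the last mutation, at [k], has created a cyclic triangle [i -> j -> k -> i]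
    whose edge [i -> j] is strictly heavier than the other two.  After at most
    two more mutations these other two have weight at least 2.  From then on,
    mutating a triangle with weights [c > a, b >= 2] at either end of the edge
    [c] replaces [a] by [b * c - a > c], or [b] by [a * c - b > c], so the new
    triangle is of the same kind.  The heaviest edge is opposite to the vertex
    mutated last, so the matrix remembers its history, and [m] steps give
    [2 ^ m] distinct matrices. *)

Set Implicit Arguments.
Unset Strict Implicit.
Unset Printing Implicit Defensive.
Import Order.TTheory GRing.Theory Num.Theory.

Local Open Scope ring_scope.

(** * Matrix mutation entry by entry, by the signs of [A i k] and [A k j] *)

Section MatrixMutation.
Variable n : nat.
Implicit Types (A : 'M[int]_n) (i j k : 'I_n).

Lemma skew_entry A : skew_symmetric A -> forall i j, A j i = - A i j.
Proof. by move=> skA i j; move/matrixP/(_ i j): skA; rewrite !mxE. Qed.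

Lemma mutate_mx_row k A j : mutate_mx k A k j = - A k j.
Proof. by rewrite mxE eqxx. Qed.

Lemma mutate_mx_col k A i : mutate_mx k A i k = - A i k.
Proof. by rewrite mxE eqxx orbT. Qed.

Lemma mutate_mx_pos k A i j : i != k -> j != k -> 0 < A i k -> 0 < A k j ->
  mutate_mx k A i j = A i j + A i k * A k j.
Proof.
move=> /negbTE ik /negbTE jk pi pj; rewrite mxE ik jk /= !gtr0_norm //.
by rewrite -mulr2n -[X in (X %/ _)%Z]mulr_natr mulzK.
Qed.

Lemma mutate_mx_neg k A i j : i != k -> j != k -> A i k < 0 -> A k j < 0 ->
  mutate_mx k A i j = A i j - A i k * A k j.
Proof.
move=> /negbTE ik /negbTE jk pi pj; rewrite mxE ik jk /= !ltr0_norm //.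
by rewrite mulNr mulrN -mulr2n -[X in (X %/ _)%Z]mulr_natr mulzK.
Qed.

Lemma mutate_mx_id k A i j : i != k -> j != k -> A i k * A k j <= 0 ->
  mutate_mx k A i j = A i j.
Proof.
move=> /negbTE ik /negbTE jk le0; rewrite mxE ik jk /=.
suff -> : `|A i k| * A k j + A i k * `|A k j| = 0 by rewrite div0z addr0.
by case: (ger0P (A i k)) => ?; case: (ger0P (A k j)) => ?; nia.
Qed.

(** Mutation flips the signs of [A i k] and [A k j] together, so their product is kept and the
    second mutation takes the opposite branch, cancelling the correction. *)
Lemma mutate_mxK k : involutive (@mutate_mx n k).
Proof.
move=> A; apply/matrixP => i j.
have [->|ik] := eqVneq i k; first by rewrite !mutate_mx_row opprK.
have [->|jk] := eqVneq j k; first by rewrite !mutate_mx_col opprK.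
have [le0|gt0] := lerP (A i k * A k j) 0.
  by rewrite mutate_mx_id ?mutate_mx_row ?mutate_mx_col ?mulrNN // mutate_mx_id.
have [pi|ni|zi] := ltgtP 0 (A i k); last by move: gt0; rewrite -zi mul0r.
- have pj : 0 < A k j by rewrite -(pmulr_rgt0 _ pi).
  rewrite mutate_mx_neg ?mutate_mx_row ?mutate_mx_col ?oppr_lt0 //.
  by rewrite mutate_mx_pos // mulrNN addrK.
- have pj : A k j < 0 by rewrite -(nmulr_rgt0 _ ni).
  rewrite mutate_mx_pos ?mutate_mx_row ?mutate_mx_col ?oppr_gt0 //.
  by rewrite mutate_mx_neg // mulrNN subrK.
Qed.

Lemma foldl_mutate_mx_skew A (ks : seq 'I_n) :
  skew_symmetric A -> skew_symmetric (foldl (fun A k => mutate_mx k A) A ks).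
Proof. by elim: ks A => //= k ks IH A skA; apply/IH/mutate_mx_skew. Qed.

Lemma foldl_mutate_snd (s : preseed n) (ks : seq 'I_n) :
  (foldl (fun t k => mutate k t) s ks).2 = foldl (fun A k => mutate_mx k A) s.2 ks.
Proof. by elim: ks s => //= k ks IH s; rewrite IH. Qed.

End MatrixMutation.

(** * Cyclic triangles with a strictly heaviest edge *)

Section Triangles.
Variable n : nat.
Implicit Types (A : 'M[int]_n) (t : 'I_n * 'I_n * 'I_n) (w : seq bool).

(* The edge [i -> j] is opposite to the vertex [k], which is to be thought of
   as the vertex mutated last. *)
Definition heavy_triangle (a : int) A t : Prop :=
  let: (i, j, k) := t in
  [/\ a <= A j k, a <= A k i, A j k < A i j & A k i < A i j].

(** The bit chooses which end of the heaviest edge is mutated. That vertex moves to the last place,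
    and the order of the other two follows the reversed orientation of the cycle. *)
Definition turn (b : bool) t :=
  let: (i, j, k) := t in if b then (k, j, i) else (i, k, j).

Definition mutate_turn (s : 'M[int]_n * ('I_n * 'I_n * 'I_n)) (b : bool) :=
  let t := turn b s.2 in (mutate_mx t.2 s.1, t).

Lemma cyclic_triangle_uniq A i j k : skew_symmetric A ->
  0 < A i j -> 0 < A j k -> 0 < A k i -> uniq [:: i; j; k].
Proof.
move=> /skew_entry sk ij jk ki; rewrite /= !inE !negb_or !andbT.
apply/andP; split; first (apply/andP; split).
- by apply/eqP => e; move: ij (sk i i); rewrite -e; lia.
- by apply/eqP => e; move: ki (sk i i); rewrite -e; lia.
- by apply/eqP => e; move: jk (sk j j); rewrite -e; lia.
Qed.

Lemma mutate_cyclic_triangle A i j k (A' := mutate_mx k A) :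
  skew_symmetric A -> 0 < A i j -> 0 < A j k -> 0 < A k i ->
  [/\ A' k j = A j k, A' i k = A k i & A' j i = A j k * A k i - A i j].
Proof.
move=> skA ij jk ki; have sk := skew_entry skA.
have := cyclic_triangle_uniq skA ij jk ki.
rewrite /= !inE !negb_or !andbT => /andP[/andP[nij nik] njk].
rewrite /A' mutate_mx_row mutate_mx_col mutate_mx_pos //.
by split; rewrite ?(sk k j) ?(sk k i) ?(sk i j); move: (sk i j) (sk j k) (sk k i); lia.
Qed.

(** With [c] the heaviest weight and [a, b] the others, [b * c - a >= 2 * c - a > c]; the two edges
    at the mutated vertex keep their weights. *)
Lemma heavy_triangle_turn A t b : skew_symmetric A ->
  heavy_triangle 2 A t -> heavy_triangle 2 (mutate_turn (A, t) b).1 (turn b t).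
Proof.
move: t => [[i j] k] skA [jk ki jk_ij ki_ij].
case: b; rewrite /mutate_turn /=.
- have [-> -> ->] := @mutate_cyclic_triangle A j k i skA ltac:(lia) ltac:(lia) ltac:(lia).
  by split; nia.
- have [-> -> ->] := @mutate_cyclic_triangle A k i j skA ltac:(lia) ltac:(lia) ltac:(lia).
  by split; nia.
Qed.

(** An odd permutation of the vertices would reverse the cycle, against skew-symmetry; a nontrivial
    rotation would move the strictly heaviest edge. *)
Lemma heavy_triangle_inj A t t' : skew_symmetric A ->
  heavy_triangle 2 A t -> heavy_triangle 2 A t' ->
  perm_eq [:: t.1.1; t.1.2; t.2] [:: t'.1.1; t'.1.2; t'.2] -> t = t'.
Proof.
move: t t' => [[i j] k] [[i' j'] k'] skA [h1 h2 h3 h4] [h1' h2' h3' h4'] /=.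
have sk := skew_entry skA.
have U : uniq [:: i; j; k] by apply: (@cyclic_triangle_uniq A) => //; lia.
move=> P; have U' : uniq [:: i'; j'; k'] by rewrite -(perm_uniq P).
have mem x : x \in [:: i'; j'; k'] -> x \in [:: i; j; k] by rewrite (perm_mem P).
have := mem i'; have := mem j'; have := mem k'; move: U U'.
rewrite !inE !eqxx !orbT /= !inE => U U' /(_ isT)/or3P K /(_ isT)/or3P J /(_ isT)/or3P I.
move: U'; case: I => /eqP eI; case: J => /eqP eJ; case: K => /eqP eK;
  subst i' j' k'; rewrite ?eqxx ?orbT //= => _;
  by move: (sk i j) (sk j k) (sk k i); lia.
Qed.

Lemma perm_turn b t :
  perm_eq [:: (turn b t).1.1; (turn b t).1.2; (turn b t).2] [:: t.1.1; t.1.2; t.2].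
Proof.
move: t => [[i j] k]; case: b => /=; apply/permP => a /=; lia.
Qed.

(** * Recovering the sequence of turns from the final matrix *)

Section History.
Variables (A : 'M[int]_n) (t : 'I_n * 'I_n * 'I_n).
Hypotheses (skA : skew_symmetric A) (heavyA : heavy_triangle 2 A t).
Let state w := foldl mutate_turn (A, t) w.

Lemma state_heavy w : [/\ skew_symmetric (state w).1,
  heavy_triangle 2 (state w).1 (state w).2 &
  perm_eq [:: (state w).2.1.1; (state w).2.1.2; (state w).2.2]
          [:: t.1.1; t.1.2; t.2]].
Proof.
rewrite /state; elim/last_ind: w => [|w b]; first by split.
rewrite foldl_rcons; case: (foldl _ _ w) => A' t' /= [sk' heavy' perm'].
split; [exact: mutate_mx_skew|exact: heavy_triangle_turn|].
exact: perm_trans (perm_turn b t') perm'.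
Qed.

(** The final matrix determines the final triangle, hence the vertex mutated last. Undoing that
    mutation gives equal previous matrices, so induction applies; the last bits agree because the
    two ends of an edge differ. *)
Lemma state_inj w w' : size w = size w' -> (state w).1 = (state w').1 -> w = w'.
Proof.
elim/last_ind: w w' => [|w b IH] w'; first by case: w'.
case/lastP: w' => [|w' b']; rewrite !size_rcons // => -[size_w] eqA.
have [sk heavy perm] := state_heavy (rcons w b).
have [_ heavy' perm'] := state_heavy (rcons w' b').
have eqt : (state (rcons w b)).2 = (state (rcons w' b')).2.
  apply: (heavy_triangle_inj sk) => //; first by rewrite eqA.
  by apply: perm_trans perm _; rewrite perm_sym.
move: eqA eqt; rewrite /state !foldl_rcons -!/(state _) /= => eqA eqt.
have eqw : w = w'.
  by apply: IH => //; move: eqA; rewrite eqt => /(can_inj (@mutate_mxK _ _)).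
move: eqt; rewrite -eqw; have [skw] := state_heavy w.
case: (state w) skw => A' [[i j] k] /= skw [h1 h2 h3 h4] _.
have := @cyclic_triangle_uniq A' i j k skw ltac:(lia) ltac:(lia) ltac:(lia).
rewrite /= !inE !negb_or => /andP[/andP[/eqP nij nik] _].
by clear -nij; case: b; case: b' => //= -[] *; congruence.
Qed.

Lemma state_reachable w : exists2 ks : seq 'I_n, size ks = size w &
  (state w).1 = foldl (fun A k => mutate_mx k A) A ks.
Proof.
rewrite /state; elim/last_ind: w => [|w b [ks size_ks IH]]; first by exists [::].
rewrite foldl_rcons /=; set t' := turn _ _.
by exists (rcons ks t'.2); rewrite ?size_rcons ?size_ks // foldl_rcons IH.
Qed.

End History.

Lemma exists_heavy_triangle2 A t : skew_symmetric A ->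
  heavy_triangle 1 A t -> 2 < A t.1.1 t.1.2 ->
  exists (ks : seq 'I_n) t',
    heavy_triangle 2 (foldl (fun A k => mutate_mx k A) A ks) t'.
Proof.
move: t => [[i j] k] skA [jk1 ki1 jk ki] /= ij.
have [jk2|jk2] := lerP 2 (A j k); have [ki2|ki2] := lerP 2 (A k i).
- by exists [::], (i, j, k).
- exists [:: j], (i, k, j) => /=.
  have [-> -> ->] := @mutate_cyclic_triangle A k i j skA ltac:(lia) ltac:(lia) ltac:(lia).
  by split; nia.
- exists [:: i], (k, j, i) => /=.
  have [-> -> ->] := @mutate_cyclic_triangle A j k i skA ltac:(lia) ltac:(lia) ltac:(lia).
  by split; nia.
(* The weights [(c, 1, 1)] become [(c, c - 1, 1)] and then [(c * (c - 1) - 1, c, c - 1)]; here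
   [c > 2] is what makes [c - 1 >= 2]. *)
- exists [:: i; j], (k, i, j) => /=.
  have [eki ekj eji] := @mutate_cyclic_triangle A j k i skA ltac:(lia) ltac:(lia) ltac:(lia).
  have [-> -> ->] := @mutate_cyclic_triangle (mutate_mx i A) i k j
    (mutate_mx_skew i skA) ltac:(lia) ltac:(nia) ltac:(lia).
  have jk_1 : A j k = 1 by lia.
  have ki_1 : A k i = 1 by lia.
  by rewrite eki ekj eji jk_1 ki_1; split; nia.
Qed.

(** Entries in row or column [k] only change sign and stay within [N], so the entry that grows is
    off them and received a nonzero correction from a path through [k]. That path, reversed by the
    mutation, closes the cycle. *)
Lemma mutate_mx_exceeds A k (N : nat) : (2 <= N)%N -> skew_symmetric A ->
  (forall i j, `|A i j|%N <= N)%N ->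
  (exists i j, N < `|mutate_mx k A i j|)%N ->
  exists2 t, heavy_triangle 1 (mutate_mx k A) t
    & 2 < mutate_mx k A t.1.1 t.1.2.
Proof.
move=> N2 skA leN; set A' := mutate_mx k A; have sk := skew_entry skA.
have skA' : skew_symmetric A' by exact: mutate_mx_skew.
(* By skew-symmetry, swapping the indices makes the large entry positive. *)
have gtN : (exists i j, N < `|A' i j|)%N -> exists i j, N%:Z < A' i j.
  case=> i [j]; have := skew_entry skA' i j.
  have [pos|neg] := ltrP 0 (A' i j) => e gtN; [exists i, j|exists j, i]; lia.
move=> gtA; have [i [j {}gtA]] := gtN gtA.
have ik : i != k.
  by apply/eqP => e; move: gtA (leN k j); rewrite e /A' mutate_mx_row; lia.
have jk : j != k.
  by apply/eqP => e; move: gtA (leN i k); rewrite e /A' mutate_mx_col; lia.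
have leAij := leN i j; have leAik := leN i k; have leAkj := leN k j.
have [le0|gt0] := lerP (A i k * A k j) 0.
  by move: gtA; rewrite /A' mutate_mx_id //; lia.
(* Two negative factors would lower the entry, which then could not exceed [N]. *)
have [neg|pos] := ltrP (A i k) 0.
  by move: gtA; rewrite /A' mutate_mx_neg //; [lia|nia].
have {}pos : 0 < A i k by nia.
have pos' : 0 < A k j by nia.
exists (i, j, k) => /=; last by lia.
by split; rewrite ?mutate_mx_row ?mutate_mx_col (sk i k, sk k j); rewrite -/A'; lia.
Qed.

End Triangles.

(** * An infinite mutation class has unbounded entries *)

Section InfiniteClass.
Import classical_sets cardinality.
Local Open Scope classical_set_scope.

Lemma finite_bounded_mx n (N : nat) :
  finite_set [set A : 'M[int]_n | forall i j, (`|A i j| <= N)%N].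
Proof.
(* Shifting by [N] encodes the interval from [-N] to [N] as an ordinal type, whose matrices form a
   finite type. *)
pose dec (M : 'M['I_(N + N).+1]_n) : 'M[int]_n :=
  map_mx (fun x : 'I_(N + N).+1 => x%:Z - N%:Z) M.
apply: (@sub_finite_set _ _ (dec @` setT)).
  move=> A leA; exists (map_mx (fun x : int => inord (absz (x + N%:Z))) A) => //.
  apply/matrixP => i j; have := leA i j; rewrite !mxE => leij.
  by rewrite inordK; lia.
exact/finite_image/finite_finset.
Qed.

Lemma mutation_infinite_exceeds n (B : 'M[int]_n) (N : nat) : mutation_infinite B ->
  exists (ks : seq 'I_n) i j, (N < `|foldl (fun A k => mutate_mx k A) B ks i j|)%N.
Proof.
move=> infB; apply: boolp.contrapT => H; apply: infB.
apply: sub_finite_set (@finite_bounded_mx n N) => _ [ks _ <-] i j.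
by rewrite leqNgt; apply/negP => gtN; apply: H; exists ks, i, j.
Qed.

End InfiniteClass.

Lemma mutation_infinite_triangle n (B : 'M[int]_n) :
  skew_symmetric B -> mutation_infinite B -> exists ks t,
    heavy_triangle 2 (foldl (fun A k => mutate_mx k A) B ks) t.
Proof.
(* The summand 2 forces the new heavy edge to have weight above 2. *)
move=> skB infB; pose N := (2 + \max_i \max_j `|B i j|)%N.
have leN i j : (`|B i j| <= N)%N.
  apply: leq_trans (leq_addl _ _).
  apply: leq_trans (leq_bigmax i).
  exact: (leq_bigmax (F := fun j => `|B i j|%N) j).
have [ks gtN] := mutation_infinite_exceeds N infB.
elim/last_ind: ks gtN => [[i [j]]|ks k IH]; first by rewrite ltnNge leN.
rewrite foldl_rcons; set A := foldl _ B ks => gtN.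
have skA : skew_symmetric A by exact: foldl_mutate_mx_skew.
(* If the bound was already exceeded before the last mutation, that mutation is dropped; otherwise
   it is the first to exceed it. *)
have [/existsP[i /existsP[j gtA]]|small] :=
  boolP [exists i, exists j, (N < `|A i j|)%N].
  by apply: IH; exists i, j.
have leA i j : (`|A i j| <= N)%N.
  by rewrite leqNgt; apply: contra small => ?; apply/existsP; exists i; apply/existsP; exists j.
have [t heavy gt2] := mutate_mx_exceeds (leq_addr _ _) skA leA gtN.
have [ks' [t' heavy']] := exists_heavy_triangle2 (mutate_mx_skew k skA) heavy gt2.
by exists (rcons ks k ++ ks'), t'; rewrite foldl_cat foldl_rcons.
Qed.

(** * Counting seeds by their matrices *)

Lemma seeds_within_lower_bound n (B : 'M[int]_n) :
  skew_symmetric B -> mutation_infinite B ->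
  exists d, forall m, (2 ^ m <= #|` seeds_within B (d + m)|)%N.
Proof.
move=> skB infB; have [ks [t heavy]] := mutation_infinite_triangle skB infB.
have skA := foldl_mutate_mx_skew ks skB; set A := foldl _ B ks in heavy skA.
(* The shift [d] pays for reaching the heavy triangle; each bit word of length [m] then costs [m]
   mutations. *)
exists (size ks) => m; set S := seeds_within _ _.
pose mx (w : m.-tuple bool) := (foldl (@mutate_turn n) (A, t) w).1.
have mx_inj : injective mx.
  move=> w w' eq_mx; apply: val_inj; apply: (state_inj skA heavy) => //.
  by rewrite !size_tuple.
have -> : (2 ^ m = size (map mx (enum {: m.-tuple bool})))%N.
  by rewrite size_map -cardE card_tuple card_bool.
rewrite -(size_map snd S); apply: uniq_leq_size.
  by rewrite map_inj_uniq // enum_uniq.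
move=> _ /mapP[w _ ->].
have [ks' size_ks' mxE] := state_reachable A t w.
pose step (s : preseed n) k := mutate k s.
apply/mapP; exists (foldl step (initial_seed B) (ks ++ ks')).
  apply/seeds_withinP; exists (ks ++ ks') => //.
  by rewrite size_cat size_ks' size_tuple.
by rewrite foldl_mutate_snd foldl_cat /mx mxE.
Qed.

Theorem theorem8p2 (R : realType) (n : nat) (B : 'M[int]_n)
    (skewB : skew_symmetric B) (infB : mutation_infinite B) :
  exponential_growth R B.
Proof.
have [d growth] := seeds_within_lower_bound skewB infB.
(* The factor [2 ^- d] absorbs the delay [d]: for [m >= d] there are at least [2 ^ (m - d)] seeds,
   and for [m < d] the initial seed alone suffices. *)
exists (2 ^- d), 2; split; rewrite ?invr_gt0 ?exprn_gt0 ?ltr1n // => m.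
rewrite mulrC ler_pdivrMr ?exprn_gt0 // -natrX -natrX -natrM ler_nat.
have [le_dm|/ltnW le_md] := leqP d m.
  have := growth (m - d)%N; rewrite subnKC // => le2.
  by rewrite -{1}(subnK le_dm) expnD leq_mul2r le2 orbT.
apply: leq_trans (_ : 2 ^ d <= _)%N; first by rewrite leq_exp2l.
rewrite leq_pmull // cardfs_gt0; apply/fset0Pn; exists (initial_seed B).
by apply/seeds_withinP; exists [::].
Qed.
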